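(* Let $n\ge1$, $\alpha,\beta>-1$ and $\sigma:=\alpha+\beta+1$. For $j=1,2,\ldots,n$, it holds (as an identity of rational functions in $t$, i.e. for all $t\neq\tau_j$) that $$dG^n_j(t;\alpha,\beta)=2\omega_j\,\frac{(n+1)(n+\sigma)}{h^{(\alpha,\beta)}_n\,(2n+\sigma)_2}\cdot\frac{b^{(\alpha,\beta)}_{n+1,j}P^{(\alpha,\beta)}_n(t)-b^{(\alpha,\beta)}_{nj}P^{(\alpha,\beta)}_{n+1}(t)-K^{(\alpha,\beta)}_n(\tau_j,t)}{\tau_j-t},$$ where $b^{(\alpha,\beta)}_{ij}:=\frac12(i+\sigma)P^{(\alpha+1,\beta+1)}_{i-1}(\tau_j)$ for $i=n,n+1$, and $$K^{(\alpha,\beta)}_n(x,y):=\frac{P^{(\alpha,\beta)}_{n+1}(x)P^{(\alpha,\beta)}_n(y)-P^{(\alpha,\beta)}_n(x)P^{(\alpha,\beta)}_{n+1}(y)}{x-y}.$$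
   Context: $\Pi_k$ is the space of real univariate polynomials of degree at most $k$. $P_k$ is the $k$th Legendre polynomial (orthogonal on $[-1,1]$ with weight $1$, normalized by $P_k(1)=1$). Fix $n\ge1$; $-1<\tau_1<\cdots<\tau_n<1$ are the zeros of $P_n$, and $\omega_i:=\dfrac{2}{nP_{n-1}(\tau_i)P_n'(\tau_i)}$ $(1\le i\le n)$ are the Gauss--Legendre weights. Polynomials $G^n_i$: $G^n_0(t)\equiv\frac12$ and, for $1\le i\le n$, $$G^n_i(t):=\frac{nP_{n-1}(\tau_i)}{2}\int_{-1}^{t}\frac{P_n(x)}{x-\tau_i}\,\mathrm{d}x-\frac12 .$$ The polynomials $G^n_0,\ldots,G^n_n$ form a basis of $\Pi_n$. Jacobi inner product: $\langle f,g\rangle_{\alpha,\beta}:=\int_{-1}^{1}(1-x)^\alpha(1+x)^\beta f(x)g(x)\,\mathrm{d}x$ $(\alpha,\beta>-1)$. The dual polynomials $dG^n_j(\cdot;\alpha,\beta)\in\Pi_n$ $(0\le j\le n)$ are defined by the conditions $\langle G^n_i,dG^n_j(\cdot;\alpha,\beta)\rangle_{\alpha,\beta}=\delta_{ij}$ for $0\le i,j\le n$. $P^{(\alpha,\beta)}_k$ is the Jacobi polynomial of degree $k$, orthogonal with respect to $\langle\cdot,\cdot\rangle_{\alpha,\beta}$ and normalized by $P^{(\alpha,\beta)}_k(1)=(\alpha+1)_k/k!$. Its squared norm is $$h^{(\alpha,\beta)}_k:=\langle P^{(\alpha,\beta)}_k,P^{(\alpha,\beta)}_k\rangle_{\alpha,\beta}=2^\sigma\frac{\Gamma(k+\alpha+1)\Gamma(k+\beta+1)}{k!\,(2k+\sigma)\,\Gamma(k+\sigma)}\qquad(k\ge1).$$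 $(z)_0:=1$, $(z)_i:=z(z+1)\cdots(z+i-1)$ is the Pochhammer symbol. *)

(* Defs.v *)
From HB Require Import structures.
From mathcomp Require Import all_boot all_order all_algebra.
From mathcomp Require Import all_classical all_reals all_analysis.
Set Implicit Arguments.
Unset Strict Implicit.
Unset Printing Implicit Defensive.
Import Order.TTheory GRing.Theory Num.Theory.
Import numFieldNormedType.Exports.
Local Open Scope classical_set_scope.
Local Open Scope ring_scope.

Definition pochhammer (R : realType) (z : R) (i : nat) : R :=
  \prod_(k < i) (z + k%:R).

(* Oriented: the sign changes when b < a. *)
Definition oriented_integral (R : realType) (a b : R) (f : R -> R) : R :=
  if a <= b then \int[lebesgue_measure]_(x in `[a, b]) f x
  else - \int[lebesgue_measure]_(x in `[b, a]) f x.

(* The endpoints are excluded because the weight may be singular there. *)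
Definition jacobi_ip (R : realType) (a b : R) (f g : R -> R) : R :=
  \int[lebesgue_measure]_(x in `]-1, 1[)
    ((1 - x) `^ a * (1 + x) `^ b * f x * g x).

Definition is_legendre (R : realType) (L : nat -> {poly R}) : Prop :=
  [/\ forall k, size (L k) = k.+1,
      forall k l, k != l ->
        \int[lebesgue_measure]_(x in `[-1, 1]) ((L k).[x] * (L l).[x]) = 0
    & forall k, (L k).[1] = 1].

Definition is_jacobi (R : realType) (a b : R) (P : nat -> {poly R}) : Prop :=
  [/\ forall k, size (P k) = k.+1,
      forall k l, k != l -> jacobi_ip a b (horner (P k)) (horner (P l)) = 0
    & forall k, (P k).[1] = pochhammer (a + 1) k / k`!%:R].

(* Nodes are numbered from 1 to n; other values of tau are irrelevant. *)
Definition is_gauss_nodes (R : realType) (L : nat -> {poly R}) (n : nat)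
    (tau : nat -> R) : Prop :=
  [/\ forall i, (1 <= i <= n)%N -> -1 < tau i < 1,
      forall i j, (1 <= i)%N -> (i < j <= n)%N -> tau i < tau j
    & forall x, root (L n) x <-> exists2 i, (1 <= i <= n)%N & x = tau i].

Definition gauss_weight (R : realType) (L : nat -> {poly R}) (n : nat)
    (tau : nat -> R) (i : nat) : R :=
  2 / (n%:R * (L n.-1).[tau i] * (L n)^`().[tau i]).

(* The integrand is not extended by continuity at x = tau i (where division
   by 0 yields 0); a single point does not affect the integral. *)
Definition Gpoly (R : realType) (L : nat -> {poly R}) (n : nat)
    (tau : nat -> R) (i : nat) (t : R) : R :=
  if i == 0%N then 1 / 2
  else n%:R * (L n.-1).[tau i] / 2
         * oriented_integral (-1) t (fun x => (L n).[x] / (x - tau i))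
       - 1 / 2.

Definition is_dual_G (R : realType) (L : nat -> {poly R}) (n : nat)
    (tau : nat -> R) (a b : R) (dG : nat -> {poly R}) : Prop :=
  (forall j, (j <= n)%N -> (size (dG j) <= n.+1)%N) /\
  (forall i j, (i <= n)%N -> (j <= n)%N ->
     jacobi_ip a b (Gpoly L n tau i) (horner (dG j)) = (i == j)%:R).

Definition jacobi_sqnorm (R : realType) (a b : R) (P : nat -> {poly R})
    (k : nat) : R :=
  jacobi_ip a b (horner (P k)) (horner (P k)).

Definition jacobi_kernel (R : realType) (P : nat -> {poly R}) (n : nat)
    (x y : R) : R :=
  ((P n.+1).[x] * (P n).[y] - (P n).[x] * (P n.+1).[y]) / (x - y).

(* Main.v *)
(* Let [s = tau_j]. As [w_i (G_i)'] is the Lagrange basis polynomial of the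
   node [tau_i], every [p] of degree at most [n] is a constant plus
   [sum_i w_i p'(tau_i) G_i]; hence [dG_j / w_j] is the representer of the
   functional [p |-> p'(s)] for the Jacobi inner product, that is, the
   derivative at [x = s] of the Christoffel-Darboux kernel. If [e] represents
   [phi] and [g] represents [p |-> phi ((s - X) p)], then [(s - X) e - g] has
   degree [n + 1] and is orthogonal to all polynomials of degree less than [n],
   so it is a combination of [P_n] and [P_(n+1)]; applying this to
   [phi p = p(s)] and then to [phi p = p'(s)] yields the closed form. The values
   [b] are the derivatives of [P_n] and [P_(n+1)] at [s], by the Jacobi
   differential equation (which fixes the value of the derivative at [1]) and
   integration by parts; the leading coefficients follow from the same
   derivative formula by induction. *)
Require Import Defs.
From HB Require Import structures.
From mathcomp Require Import all_boot all_order all_algebra.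
From mathcomp Require Import all_classical all_reals all_analysis.
From mathcomp Require Import measurable_realfun ring lra.
Import Order.TTheory GRing.Theory Num.Theory.
Import numFieldNormedType.Exports.
Local Open Scope classical_set_scope.
Local Open Scope ring_scope.

(** * Integrals over open intervals *)

(** Every margin [e i] is at most [(b - a) / 3], so no closed interval degenerates, and the margins
    tend to [0], so each interior point is eventually captured. *)
Lemma itv_oo_bigcup_cc (R : realType) (a b : R) : a < b ->
  let e (i : nat) := (b - a) / 3 * i.+1%:R^-1 in
  `]a, b[%classic = \bigcup_i `[a + e i, b - e i]%classic.
Proof.
move=> ab e; have e0 i : 0 < e i.
  by rewrite mulr_gt0 ?invr_gt0 // divr_gt0 // subr_gt0.
apply/seteqP; split => [x /= /[!in_itv]/= /andP[ax xb]|x [i _] /=]; last first.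
  by rewrite !in_itv /=; move: (e0 i) => ei /andP[? ?]; apply/andP; split; lra.
have m0 : 0 < Num.min (x - a) (b - x) by rewrite lt_min !subr_gt0 ax xb.
have : e @ \oo --> (0 : R).
  have -> : (0 : R) = (b - a) / 3 * 0 by rewrite mulr0.
  by apply: cvgM; [exact: cvg_cst|exact: cvg_harmonic].
move/cvgrPdist_lt => /(_ _ m0) [N _ /(_ N (leqnn N))] /=.
rewrite sub0r normrN gtr0_norm // lt_min => /andP[? ?].
by exists N => //=; rewrite in_itv /=; apply/andP; split; lra.
Qed.

(** The integrand may blow up at the end points. On compact subintervals the usual fundamental
    theorem applies; monotone convergence handles the integrals, and the one-sided limits of [F]
    handle the right-hand side. *)
Lemma ge0_FTC2_oo (R : realType) (f F : R -> R) (a b : R) : a < b ->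
  {in `]a, b[, continuous f} -> {in `]a, b[, forall x, 0 <= f x} ->
  {in `]a, b[, forall x, is_derive (x : R) (1 : R) F (f x)} ->
  F @ a^'+ --> F a -> F @ b^'- --> F b ->
  (\int[lebesgue_measure]_(x in `]a, b[) (f x)%:E = (F b - F a)%:E)%E.
Proof.
move=> ab cf f0 Ff Fa Fb.
pose e (i : nat) := (b - a) / 3 * i.+1%:R^-1.
have e0 i : 0 < e i by rewrite mulr_gt0 ?invr_gt0 // divr_gt0 // subr_gt0.
have e3 i : e i <= (b - a) / 3.
  apply: ler_piMr; first by rewrite divr_ge0 // subr_ge0 ltW.
  by rewrite invf_le1 ?ler1n // ltr0n.
have ecvg : e @ \oo --> (0 : R).
  have -> : (0 : R) = (b - a) / 3 * 0 by rewrite mulr0.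
  by apply: cvgM; [exact: cvg_cst|exact: cvg_harmonic].
have sub i x : `[a + e i, b - e i]%classic x -> x \in `]a, b[.
  rewrite /= !in_itv /=; move: (e0 i) => ei /andP[? ?]; apply/andP; split; lra.
have cvI : (\int[lebesgue_measure]_(x in `[(a + e i)%R, (b - e i)%R]) (f x)%:E
    @[i --> \oo] --> \int[lebesgue_measure]_(x in `]a, b[) (f x)%:E)%E.
  rewrite (itv_oo_bigcup_cc _ _ _ ab).
  apply: ge0_nondecreasing_set_cvg_integral => //.
  - have le_e i : e i.+1 <= e i.
      rewrite /e ler_wpM2l ?divr_ge0 ?subr_ge0 //; first exact: ltW.
      by rewrite lef_pV2 ?posrE // ler_nat.
    apply/nondecreasing_seqP => i; rewrite subsetEset; apply: subset_itv.
      by rewrite bnd_simp lerD2l.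
    by rewrite bnd_simp lerD2l lerN2.
  - move=> i; apply/measurable_EFinP.
    apply: subspace_continuous_measurable_fun => //.
    apply: continuous_in_subspaceT => x; rewrite inE => /sub; exact: cf.
  - by move=> i x /sub /f0; rewrite lee_fin.
have cvF : (\int[lebesgue_measure]_(x in `[(a + e i)%R, (b - e i)%R]) (f x)%:E
    @[i --> \oo] --> (F b - F a)%R%:E)%E.
  have -> : (fun i => \int[lebesgue_measure]_(x in
      `[(a + e i)%R, (b - e i)%R]) (f x)%:E)%E
      = (fun i => (F (b - e i) - F (a + e i))%:E).
    apply/funext => i.
    have ei : a + e i < b - e i by move: (e3 i) (e0 i); lra.
    have cF x : `[a + e i, b - e i]%classic x -> {for x, continuous F}.
      move=> /sub /Ff [dF _]; apply/differentiable_continuous.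
      by apply/derivable1_diffP.
    rewrite (@continuous_FTC2 _ f F) ?EFinB //.
    - apply: continuous_in_subspaceT => x; rewrite inE => /sub; exact: cf.
    - split.
      + move=> x xi; have /Ff [] // : x \in `]a, b[.
        by apply: (sub i); apply: subset_itv_oo_cc.
      + by apply: cvg_at_right_filter; apply: cF; rewrite /= bound_itvE ltW.
      + by apply: cvg_at_left_filter; apply: cF; rewrite /= bound_itvE ltW.
    - move=> x xi; have /Ff dF : x \in `]a, b[.
        by apply: (sub i); apply: subset_itv_oo_cc.
      by rewrite derive1E derive_val.
  apply: cvg_EFin; first by apply: nearW.
  apply: cvgB.
  - move/cvg_at_leftP : Fb; apply; split => [i|]; first by rewrite gtrBl.
    by rewrite -[X in _ --> X]subr0; apply: cvgB => //; exact: cvg_cst.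
  - move/cvg_at_rightP : Fa; apply; split => [i|]; first by rewrite ltrDl.
    by rewrite -[X in _ --> X]addr0; apply: cvgD => //; exact: cvg_cst.
exact: (cvg_unique _ cvI cvF).
Qed.

Lemma continuous_oo_measurable (R : realType) (f : R -> R) (a b : R) :
  {in `]a, b[, continuous f} ->
  measurable_fun `]a, b[%classic (EFin \o f).
Proof.
move=> cf; apply/measurable_EFinP; apply: open_continuous_measurable_fun.
  exact: itv_open.
by move=> x; rewrite inE => /cf.
Qed.

(** The limits of [G] at the end points make the integral of the nonnegative [g] finite;
    integrability of [f] follows by comparison. *)
Lemma dominated_integrable_oo (R : realType) (f g G : R -> R) (a b : R) :
  a < b -> {in `]a, b[, continuous f} -> {in `]a, b[, continuous g} ->
  {in `]a, b[, forall x, `|f x| <= g x} ->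
  {in `]a, b[, forall x, is_derive (x : R) (1 : R) G (g x)} ->
  G @ a^'+ --> G a -> G @ b^'- --> G b ->
  lebesgue_measure.-integrable `]a, b[ (EFin \o f).
Proof.
move=> ab cf cg fg Gg Ga Gb.
have g0 : {in `]a, b[, forall x, 0 <= g x} by move=> x /fg; apply: le_trans.
apply: (@le_integrable _ _ R lebesgue_measure `]a, b[%classic _ _
  (EFin \o g)) => //.
- exact: continuous_oo_measurable.
- move=> x xab /=; rewrite lee_fin [leRHS]ger0_norm; first exact: fg.
  exact: g0.
- apply/integrableP; split; first exact: continuous_oo_measurable.
  have -> : (\int[lebesgue_measure]_(x in `]a, b[) `|(EFin \o g) x| =
             \int[lebesgue_measure]_(x in `]a, b[) (g x)%:E)%E.
    by apply: eq_integral => x; rewrite inE => xab /=; rewrite ger0_norm // g0.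
  by rewrite (ge0_FTC2_oo _ _ _ _ _ ab cg g0 Gg Ga Gb) ltry.
Qed.

Lemma dominated_FTC2_oo (R : realType) (f F g G : R -> R) (a b : R) : a < b ->
  {in `]a, b[, continuous f} -> {in `]a, b[, continuous g} ->
  {in `]a, b[, forall x, `|f x| <= g x} ->
  {in `]a, b[, forall x, is_derive (x : R) (1 : R) F (f x)} ->
  F @ a^'+ --> F a -> F @ b^'- --> F b ->
  {in `]a, b[, forall x, is_derive (x : R) (1 : R) G (g x)} ->
  G @ a^'+ --> G a -> G @ b^'- --> G b ->
  \int[lebesgue_measure]_(x in `]a, b[) f x = F b - F a.
Proof.
move=> ab cf cg fg Ff Fa Fb Gg Ga Gb.
have intf := dominated_integrable_oo _ _ _ _ _ _ ab cf cg fg Gg Ga Gb.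
have g0 : {in `]a, b[, forall x, 0 <= g x} by move=> x /fg; apply: le_trans.
have intg : lebesgue_measure.-integrable `]a, b[ (EFin \o g).
  apply: (dominated_integrable_oo _ _ _ _ _ _ ab cg cg) Ga Gb => // x xab.
  by rewrite ger0_norm // g0.
(* [f + g] is nonnegative, so that the nonnegative case applies to it. *)
have h : \int[lebesgue_measure]_(x in `]a, b[) (f x + g x) =
    F b + G b - (F a + G a).
  rewrite /Rintegral (@ge0_FTC2_oo _ _ (fun x => F x + G x)) //.
  - by move=> x xab; apply: cvgD; [exact: cf|exact: cg].
  - by move=> x /fg; rewrite ler_norml => /andP[+ _]; rewrite -subr_ge0 opprK.
  - by move=> x xab; apply: is_deriveD; [exact: Ff|exact: Gg].
  - exact: cvgD.
  - exact: cvgD.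
have hD : \int[lebesgue_measure]_(x in `]a, b[) (f x + g x) =
    \int[lebesgue_measure]_(x in `]a, b[) f x +
    \int[lebesgue_measure]_(x in `]a, b[) g x.
  exact: RintegralD.
have hg : \int[lebesgue_measure]_(x in `]a, b[) g x = G b - G a.
  by rewrite /Rintegral (ge0_FTC2_oo _ _ _ _ _ ab cg g0 Gg Ga Gb).
by apply: (addIr (G b - G a)); rewrite -{1}hg -hD h; ring.
Qed.

(** * The Jacobi weight *)

Definition jacobi_weight (R : realType) (a b x : R) : R :=
  (1 - x) `^ a * (1 + x) `^ b.

Lemma is_derive_powR1B (R : realType) (c x : R) : x < 1 ->
  is_derive (x : R) (1 : R) (fun y : R => (1 - y) `^ c)
    (- (c * (1 - x) `^ (c - 1))).
Proof.
move=> x1; have x1' : 0 < 1 - x by rewrite subr_gt0.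
have dB : is_derive (x : R) (1 : R) (fun y : R => 1 - y) (-1).
  rewrite -[X in is_derive _ _ _ X]sub0r.
  exact: is_deriveB (is_derive_cst (1 : R) x 1) (is_derive_id x 1).
have := @is_derive1_comp _ (fun y : R => y `^ c) (fun y => 1 - y) x _ _
  (is_derive1_powR c x1') dB.
by rewrite mulrN1.
Qed.

Lemma is_derive_powR1D (R : realType) (c x : R) : -1 < x ->
  is_derive (x : R) (1 : R) (fun y : R => (1 + y) `^ c)
    (c * (1 + x) `^ (c - 1)).
Proof.
move=> x1; have x1' : 0 < 1 + x by rewrite -ltrBlDl sub0r.
have dD : is_derive (x : R) (1 : R) (fun y : R => 1 + y) 1.
  rewrite -[X in is_derive _ _ _ X]add0r.
  exact: is_deriveD (is_derive_cst (1 : R) x 1) (is_derive_id x 1).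
have := @is_derive1_comp _ (fun y : R => y `^ c) (fun y => 1 + y) x _ _
  (is_derive1_powR c x1') dD.
by rewrite mulr1.
Qed.

Lemma is_derive1_continuous (R : realType) (f : R -> R) (x d : R) :
  is_derive (x : R) (1 : R) f d -> {for x, continuous f}.
Proof.
by move=> [df _]; apply/differentiable_continuous/derivable1_diffP.
Qed.

Lemma jacobi_weight_continuous (R : realType) (a b : R) :
  {in `]-1, 1[, continuous (jacobi_weight R a b)}.
Proof.
move=> x /[!in_itv]/= /andP[x0 x1]; apply: cvgM.
  exact: (is_derive1_continuous _ _ _ _ (is_derive_powR1B _ _ _ x1)).
exact: (is_derive1_continuous _ _ _ _ (is_derive_powR1D _ _ _ x0)).
Qed.

Lemma jacobi_weight_gt0 (R : realType) (a b x : R) :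
  x \in `]-1, 1[ -> 0 < jacobi_weight R a b x.
Proof.
rewrite in_itv /= => /andP[x0 x1]; apply: mulr_gt0; apply: powR_gt0; lra.
Qed.

Lemma cvg_powR1B (R : realType) (c : R) : 0 < c ->
  (fun y : R => (1 - y) `^ c) @ 1^'- --> (0 : R).
Proof.
move=> c0; apply/cvg_at_leftP => u [u1 ucvg].
have /cvg_at_rightP := powR_cvg0 c0; apply; split.
  by move=> i; rewrite subr_gt0.
by rewrite -[X in _ --> X](subrr 1); apply: cvgB => //; exact: cvg_cst.
Qed.

Lemma cvg_powR1D (R : realType) (c : R) : 0 < c ->
  (fun y : R => (1 + y) `^ c) @ (-1)^'+ --> (0 : R).
Proof.
move=> c0; apply/cvg_at_rightP => u [u1 ucvg].
have /cvg_at_rightP := powR_cvg0 c0; apply; split.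
  by move=> i; move: (u1 i); rewrite -ltrBlDl sub0r.
by rewrite -[X in _ --> X](subrr 1); apply: cvgD => //; exact: cvg_cst.
Qed.

Lemma horner_bounded (R : realType) (p : {poly R}) :
  exists2 C : R, 0 <= C & {in `]-1, 1[, forall x, `|p.[x]| <= C}.
Proof.
elim/poly_ind: p => [|p c [C C0 pC]].
  by exists 0 => // x _; rewrite horner0 normr0.
exists (C + `|c|); first by rewrite addr_ge0.
move=> x xI; rewrite !hornerE (le_trans (ler_normD _ _)) // lerD2r normrM.
rewrite -[leRHS]mulr1 ler_pM ?pC //.
by move: xI; rewrite in_itv /= ler_norml => /andP[/ltW-> /ltW->].
Qed.

Lemma powR_le_powR_norm (R : realType) (c y : R) :
  1 <= y <= 2 -> y `^ c <= 2 `^ `|c|.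
Proof.
move=> /andP[y1 y2]; apply: (@le_trans _ _ (y `^ `|c|)).
  by apply: ler_powR => //; exact: ler_norm.
by apply: ge0_ler_powR => //; rewrite nnegrE // (le_trans ler01).
Qed.

(** At most one factor of the weight is singular near a given point: for [x >= 0] the base [1 + x]
    lies in [[1, 2]], for [x < 0] the base [1 - x] does. The bound separates the two powers, so that
    it has an elementary primitive. *)
Lemma jacobi_weight_le (R : realType) (a b x : R) : x \in `]-1, 1[ ->
  jacobi_weight R a b x <=
  (2 `^ `|a| + 2 `^ `|b|) * ((1 - x) `^ a + (1 + x) `^ b).
Proof.
rewrite in_itv /= => /andP[x0 x1]; rewrite /jacobi_weight.
have A : 0 <= 2 `^ `|a| :> R by exact: powR_ge0.
have B : 0 <= 2 `^ `|b| :> R by exact: powR_ge0.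
have u : 0 <= (1 - x) `^ a by exact: powR_ge0.
have v : 0 <= (1 + x) `^ b by exact: powR_ge0.
have [h|h] := leP 0 x.
- have /(powR_le_powR_norm _ b) w : 1 <= 1 + x <= 2 by apply/andP; split; lra.
  apply: (@le_trans _ _ ((1 - x) `^ a * 2 `^ `|b|)); first exact: ler_wpM2l.
  rewrite mulrC; apply: ler_pM => //; by rewrite ?lerDl ?lerDr.
- have /(powR_le_powR_norm _ a) w : 1 <= 1 - x <= 2 by apply/andP; split; lra.
  apply: (@le_trans _ _ (2 `^ `|a| * (1 + x) `^ b)); first exact: ler_wpM2r.
  by apply: ler_pM => //; rewrite ?lerDl ?lerDr.
Qed.

(** The primitive involves the exponents [a + 1] and [b + 1]. They are positive, which gives [G]
    finite limits at the end points, equal to its values there because [0] to a nonzero power is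
    [0]. *)
Lemma jacobi_weight_horner_dominated (R : realType) (a b : R) (r : {poly R}) :
  -1 < a -> -1 < b -> exists g G : R -> R,
  [/\ {in `]-1, 1[, continuous g},
      {in `]-1, 1[, forall x, `|jacobi_weight R a b x * r.[x]| <= g x},
      {in `]-1, 1[, forall x, is_derive (x : R) (1 : R) G (g x)},
      G @ (-1)^'+ --> G (-1) & G @ 1^'- --> G 1].
Proof.
move=> a1 b1; have [C C0 rC] := horner_bounded _ r.
have a1' : 0 < a + 1 by rewrite -ltrBlDr sub0r.
have b1' : 0 < b + 1 by rewrite -ltrBlDr sub0r.
pose M : R := (2 `^ `|a| + 2 `^ `|b|) * C.
exists (fun x => M * ((1 - x) `^ a + (1 + x) `^ b)).
exists (fun x => M * (- (a + 1)^-1 * (1 - x) `^ (a + 1) +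
                      (b + 1)^-1 * (1 + x) `^ (b + 1))).
split.
- move=> x /[!in_itv]/= /andP[x0 x1].
  apply: cvgM; [exact: cvg_cst|apply: cvgD].
    exact: (is_derive1_continuous _ _ _ _ (is_derive_powR1B _ _ _ x1)).
  exact: (is_derive1_continuous _ _ _ _ (is_derive_powR1D _ _ _ x0)).
- move=> x xI; have w0 := jacobi_weight_gt0 _ a b _ xI.
  rewrite normrM (gtr0_norm w0) [leRHS]mulrAC.
  apply: ler_pM; [exact: ltW|exact: normr_ge0| |exact: rC].
  exact: jacobi_weight_le.
- move=> x /[!in_itv]/= /andP[x0 x1].
  have dA := is_derive_powR1B _ (a + 1) _ x1.
  have dB := is_derive_powR1D _ (b + 1) _ x0.
  have -> : M * ((1 - x) `^ a + (1 + x) `^ b) =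
      M *: (- (a + 1)^-1 *: (- ((a + 1) * (1 - x) `^ (a + 1 - 1))) +
            (b + 1)^-1 *: ((b + 1) * (1 + x) `^ (b + 1 - 1))).
    rewrite !addrK /GRing.scale /= mulrNN !mulKf ?gt_eqF //.
  exact: (is_deriveZ M (is_deriveD (is_deriveZ (- (a + 1)^-1) dA)
            (is_deriveZ (b + 1)^-1 dB))).
- apply: cvgM; [exact: cvg_cst|apply: cvgD; apply: cvgM; try exact: cvg_cst].
    apply: cvg_at_right_filter.
  apply: (is_derive1_continuous _ _ _ _ (is_derive_powR1B _ _ _ _)).
    by rewrite gtrN.
  by rewrite subrr powR0 ?gt_eqF //; exact: cvg_powR1D.
- apply: cvgM; [exact: cvg_cst|apply: cvgD; apply: cvgM; try exact: cvg_cst].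
    by rewrite subrr powR0 ?gt_eqF //; exact: cvg_powR1B.
  apply: cvg_at_left_filter.
  apply: (is_derive1_continuous _ _ _ _ (is_derive_powR1D _ _ _ _)).
  by rewrite gtrN.
Qed.

Lemma jacobi_weight_horner_continuous (R : realType) (a b : R) (r : {poly R}) :
  {in `]-1, 1[, continuous (fun x => jacobi_weight R a b x * r.[x])}.
Proof.
move=> x xI; apply: cvgM; first exact: jacobi_weight_continuous.
exact: continuous_horner.
Qed.

Lemma jacobi_weight_horner_integrable (R : realType) (a b : R) (r : {poly R}) :
  -1 < a -> -1 < b ->
  lebesgue_measure.-integrable `]-1, 1[
    (EFin \o (fun x => jacobi_weight R a b x * r.[x])).
Proof.
move=> a1 b1.
have [g [G [cg fg dG Gl Gr]]] := jacobi_weight_horner_dominated _ _ _ r a1 b1.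
apply: (dominated_integrable_oo _ _ g G) => //.
exact: jacobi_weight_horner_continuous.
Qed.

(** The inner product depends only on the product of its two arguments, so a single linear form on
    polynomials carries all of it; the later arguments are then algebraic. *)
Definition jacobi_functional (R : realType) (a b : R) (r : {poly R}) : R :=
  \int[lebesgue_measure]_(x in `]-1, 1[) (jacobi_weight R a b x * r.[x]).

Lemma jacobi_ipE (R : realType) (a b : R) (p q : {poly R}) :
  jacobi_ip a b (horner p) (horner q) = jacobi_functional R a b (p * q).
Proof. by apply: eq_Rintegral => x _; rewrite hornerM mulrA. Qed.

Lemma jacobi_functional_linear (R : realType) (a b : R) : -1 < a -> -1 < b ->
  GRing.linear_for *%R (jacobi_functional R a b).
Proof.
move=> a1 b1 c p q; rewrite /jacobi_functional.
have intp := jacobi_weight_horner_integrable _ _ _ p a1 b1.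
have intq := jacobi_weight_horner_integrable _ _ _ q a1 b1.
have intcp := jacobi_weight_horner_integrable _ _ _ (c *: p) a1 b1.
rewrite -RintegralZl // -RintegralD //; last first.
  move: intcp; congr (integrable _ _ _); apply/funext => x /=.
  by rewrite hornerZ mulrCA.
by apply: eq_Rintegral => x _; rewrite hornerD hornerZ mulrDr mulrCA.
Qed.

Lemma powRDr1 (R : realType) (c y : R) : 0 < y -> y `^ (c + 1) = y `^ c * y.
Proof.
move=> y0; rewrite powRD ?powRr1 ?ltW //.
by rewrite (gt_eqF y0) implybT.
Qed.

Lemma jacobi_weightS (R : realType) (a b x : R) : x \in `]-1, 1[ ->
  jacobi_weight R (a + 1) (b + 1) x = jacobi_weight R a b x * (1 - x ^+ 2).
Proof.
rewrite in_itv /= => /andP[x0 x1]; rewrite /jacobi_weight.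
have u0 : 0 < 1 - x by rewrite subr_gt0.
have v0 : 0 < 1 + x by rewrite -ltrBlDl sub0r.
rewrite !powRDr1 //; ring.
Qed.

Lemma jacobi_functionalS (R : realType) (a b : R) (r : {poly R}) :
  jacobi_functional R (a + 1) (b + 1) r =
  jacobi_functional R a b ((1 - 'X ^+ 2) * r).
Proof.
apply: eq_Rintegral => x; rewrite inE => xI.
rewrite jacobi_weightS // hornerM !(hornerD, hornerN, hornerC, hornerXn).
by rewrite mulrA.
Qed.

(** The integrand is the derivative of [F], which vanishes at both end points since its exponents
    [a + 1] and [b + 1] are positive. *)
Lemma jacobi_functional_pearson (R : realType) (a b : R) (q : {poly R}) :
  -1 < a -> -1 < b ->
  jacobi_functional R a b ((1 - 'X ^+ 2) * q^`() +
    ((b - a)%:P - (a + b + 2) *: 'X) * q) = 0.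
Proof.
move=> a1 b1; set r := _ + _.
have a1' : 0 < a + 1 by rewrite -ltrBlDr sub0r.
have b1' : 0 < b + 1 by rewrite -ltrBlDr sub0r.
have [g [G [cg fg dG Gl Gr]]] := jacobi_weight_horner_dominated _ _ _ r a1 b1.
pose F (x : R) : R := (1 - x) `^ (a + 1) * (1 + x) `^ (b + 1) * q.[x].
have F1 : F 1 = 0 by rewrite /F subrr powR0 ?gt_eqF // !mul0r.
have FN1 : F (-1) = 0 by rewrite /F subrr powR0 ?gt_eqF // mulr0 mul0r.
rewrite /jacobi_functional (dominated_FTC2_oo _ _ F g G) ?F1 ?FN1 ?subr0 //.
- exact: jacobi_weight_horner_continuous.
- move=> x; rewrite in_itv /= => /andP[x0 x1].
  have dA := is_derive_powR1B _ (a + 1) _ x1.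
  have dB := is_derive_powR1D _ (b + 1) _ x0.
  have := is_deriveM (is_deriveM dA dB) (is_derive_poly q x).
  congr (is_derive _ _ _ _).
  have u0 : 0 < 1 - x by rewrite subr_gt0.
  have v0 : 0 < 1 + x by rewrite -ltrBlDl sub0r.
  rewrite /r /GRing.scale !fctE /= !addrK /jacobi_weight.
  rewrite !powRDr1 //.
  rewrite !(hornerD, hornerN, hornerM, hornerC, hornerXn, hornerX, hornerZ).
  by ring.
- have -> : (0 : R) = (1 - (-1)) `^ (a + 1) * 0 * q.[-1] by rewrite mulr0 mul0r.
  apply: cvgM; last by apply: cvg_at_right_filter; exact: continuous_horner.
  apply: cvgM; last exact: cvg_powR1D.
  apply: cvg_at_right_filter.
  apply: (is_derive1_continuous _ _ _ _ (is_derive_powR1B _ _ _ _)).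
  by rewrite gtrN.
- have -> : (0 : R) = 0 * (1 + 1) `^ (b + 1) * q.[1] by rewrite !mul0r.
  apply: cvgM; last by apply: cvg_at_left_filter; exact: continuous_horner.
  apply: cvgM; first exact: cvg_powR1B.
  apply: cvg_at_left_filter.
  apply: (is_derive1_continuous _ _ _ _ (is_derive_powR1D _ _ _ _)).
  by rewrite gtrN.
Qed.

Lemma finite_set_root (F : idomainType) (p : {poly F}) :
  p != 0 -> finite_set [set x | root p x].
Proof.
have [m] := ubnP (size p); elim: m => // m IH in p *; rewrite ltnS => pm p0.
have [[x px]|nroot] := pselect (exists x, root p x); last first.
  rewrite (_ : [set _ | _] = set0) //; apply/seteqP; split => // x px.
  by apply: nroot; exists x.
have /factor_theorem [q pE] := px.
have q0 : q != 0 by apply: contraNneq p0 => q0; rewrite pE q0 mul0r.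
apply: (@sub_finite_set _ _ ([set y | root q y] `|` [set x])).
  by move=> y /=; rewrite pE rootM root_XsubC => /orP[|/eqP]; [left|right].
rewrite finite_setU; split; last exact: finite_set1.
apply: IH => //; move: pm; rewrite pE size_mul ?polyXsubC_eq0 //.
by rewrite size_XsubC addn2 /=.
Qed.

(** If the integral were zero, the nonnegative integrand would vanish almost everywhere. As the
    weight is positive, []-1, 1[] would be covered by a null set and the finitely many roots of [p],
    although its measure is [2]. *)
Lemma jacobi_functional_sqr_gt0 (R : realType) (a b : R) (p : {poly R}) :
  -1 < a -> -1 < b -> p != 0 -> 0 < jacobi_functional R a b (p * p).
Proof.
move=> a1 b1 p0.
have intp := jacobi_weight_horner_integrable _ _ _ (p * p) a1 b1.
have pp0 x : x \in `]-1, 1[ -> 0 <= jacobi_weight R a b x * (p * p).[x].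
  move=> xI; rewrite mulr_ge0 ?(ltW (jacobi_weight_gt0 _ _ _ _ xI)) //.
  by rewrite hornerM -expr2 sqr_ge0.
rewrite lt_neqAle Rintegral_ge0 // andbT eq_sym; apply/eqP => int0.
pose D : set R := `]-1, 1[%classic.
pose f : R -> R := fun x => jacobi_weight R a b x * (p * p).[x].
have : (\int[lebesgue_measure]_(x in D) `|(EFin \o f) x| = 0)%E.
  transitivity (\int[lebesgue_measure]_(x in D) (EFin \o f) x)%E.
    by apply: eq_integral => x; rewrite inE => xI /=; rewrite ger0_norm // pp0.
  rewrite -[RHS]/((0 : R)%:E) -int0 /jacobi_functional /Rintegral fineK //.
  exact: integrable_fin_num.
move/(ae_eq_integral_abs lebesgue_measure (measurable_itv _)) => /(_ _)/=.
case; first by case/integrableP : intp.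
move=> N [mN N0 sN].
have pN : `]-1, 1[ `<=` N `|` [set x | root p x].
  move=> x xI; have [rx|rx] := boolP (root p x); [by right|left].
  apply: sN => /= /(_ xI) [] /eqP.
  rewrite mulf_eq0 (gt_eqF (jacobi_weight_gt0 _ _ _ _ xI)) hornerM mulf_eq0.
  by rewrite orbb -rootE (negbTE rx).
have cr : countable [set x | root p x].
  by apply: finite_set_countable; exact: finite_set_root.
have root0 := countable_lebesgue_measure0 cr.
have mr : measurable ([set x | root p x] : set R).
  by apply: countable_measurable => // x; exact: measurable_set1.
have : (lebesgue_measure D <= lebesgue_measure (N `|` [set x | root p x]))%E.
  apply: le_measure; rewrite ?inE //; first exact: measurable_itv.
  exact: measurableU mN mr.
rewrite [leRHS](null_set_setU mN mr N0 root0) lebesgue_measure_itv /= lte_fin.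
by rewrite gtrN // -EFinB lee_fin opprK leNgt addr_gt0.
Qed.

(** * The polynomials [G_i] *)

(** At [i = 0] division by zero yields [0], so this primitive has zero constant term. *)
Definition poly_primitive (F : fieldType) (p : {poly F}) : {poly F} :=
  \poly_(i < (size p).+1) (p`_i.-1 / i%:R).

Lemma deriv_primitive (F : numFieldType) (p : {poly F}) :
  (poly_primitive F p)^`() = p.
Proof.
apply/polyP => i; rewrite coef_deriv coef_poly ltnS /=.
have [ip|ip] := ltnP i (size p); last by rewrite mul0rn nth_default.
by rewrite -[LHS]mulr_natr divfK // pnatr_eq0.
Qed.

Lemma size_poly_primitive (F : fieldType) (p : {poly F}) :
  (size (poly_primitive F p) <= (size p).+1)%N.
Proof. exact: size_poly. Qed.

Lemma root_divp_XsubC (F : fieldType) (p : {poly F}) (s : F) :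
  root p s -> p = (p %/ ('X - s%:P)) * ('X - s%:P).
Proof. by move=> ps; rewrite divpK // dvdp_XsubCl. Qed.

Lemma oriented_integral_quotient (R : realType) (p : {poly R}) (s t : R) :
  root p s -> -1 < t ->
  oriented_integral (-1) t (fun x => p.[x] / (x - s)) =
  (poly_primitive R (p %/ ('X - s%:P))).[t] -
  (poly_primitive R (p %/ ('X - s%:P))).[-1].
Proof.
move=> ps t1; set q := p %/ ('X - s%:P); set Q := poly_primitive R q.
have pE x : p.[x] = q.[x] * (x - s).
  by rewrite [in LHS](root_divp_XsubC _ _ _ ps) hornerM hornerXsubC.
rewrite /oriented_integral ltW //.
(* At [x = s] the quotient is [0] by the convention on division, while [q] may be nonzero there.
   Deleting the point from the domain reconciles the two and does not change the integral of [q]. *)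
have -> : \int[lebesgue_measure]_(x in `[-1, t]) (p.[x] / (x - s)) =
    \int[lebesgue_measure]_(x in `[-1, t] `\ s) q.[x].
  rewrite setDE Rintegral_mkcondr; apply: eq_Rintegral => x _.
  rewrite patchE; case: ifPn; rewrite ?inE /= => xs.
    by rewrite pE mulfK // subr_eq0; apply/eqP.
  by move: xs; rewrite notin_setE => /contrapT ->; rewrite subrr invr0 mulr0.
rewrite /Rintegral integral_setD1; last 2 first.
- by apply: measurableD.
- by apply/measurable_EFinP; apply: measurable_poly.
rewrite (@continuous_FTC2 _ _ (horner Q)) //.
- by apply: continuous_subspaceT; exact: continuous_horner.
- split; first by move=> x _; exact: derivable_horner.
    by apply: cvg_at_right_filter; exact: continuous_horner.
  by apply: cvg_at_left_filter; exact: continuous_horner.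
- by move=> x _; rewrite -derivE deriv_primitive.
Qed.

(** Polynomial form of [Gpoly] for positive indices only; index [0] is a constant and is treated
    separately. *)
Definition Gauss_poly (R : realType) (L : nat -> {poly R}) (n : nat)
    (tau : nat -> R) (i : nat) : {poly R} :=
  let Q := poly_primitive R (L n %/ ('X - (tau i)%:P)) in
  (n%:R * (L n.-1).[tau i] / 2) *: (Q - Q.[-1]%:P) - (1 / 2)%:P.

Lemma GpolyE (R : realType) (L : nat -> {poly R}) (n : nat)
    (tau : nat -> R) (i : nat) (t : R) :
  (0 < i)%N -> root (L n) (tau i) -> -1 < t ->
  Gpoly L n tau i t = (Gauss_poly R L n tau i).[t].
Proof.
move=> i0 ri t1; rewrite /Gpoly /Gauss_poly eqn0Ngt i0 /=.
by rewrite oriented_integral_quotient // !(hornerE, hornerZ).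
Qed.

(** * Christoffel-Darboux formulas *)

(** Positivity of the inner product is weakened to nonzero square norms, so that the theory makes
    sense over any field. *)
Definition orthogonal_system (F : fieldType) (ell : {scalar {poly F}})
    (Q : nat -> {poly F}) : Prop :=
  [/\ forall k, size (Q k) = k.+1,
      forall k l, k != l -> ell (Q k * Q l) = 0
    & forall k, ell (Q k * Q k) != 0].

Lemma graded_lead_coef (F : fieldType) (Q : nat -> {poly F}) (k : nat) :
  size (Q k) = k.+1 -> lead_coef (Q k) = (Q k)`_k.
Proof. by move=> sQ; rewrite lead_coefE sQ. Qed.

Lemma graded_expansion (F : fieldType) (Q : nat -> {poly F}) :
  (forall k, size (Q k) = k.+1) -> forall (m : nat) (p : {poly F}),
  (size p <= m)%N -> exists c : nat -> F, p = \sum_(k < m) c k *: Q k.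
Proof.
move=> sQ; elim=> [|m IH] p pm.
  by exists (fun=> 0); rewrite big_ord0; apply/eqP; rewrite -size_poly_leq0.
have lQ : lead_coef (Q m) != 0 by rewrite lead_coef_eq0 -size_poly_eq0 sQ.
pose c0 := p`_m / lead_coef (Q m).
have /IH [c pc] : (size (p - c0 *: Q m)%R <= m)%N.
  apply/leq_sizeP => j; rewrite leq_eqVlt coefB coefZ => /predU1P[<-|mj].
    by rewrite -(graded_lead_coef _ _ _ (sQ m)) divfK ?subrr.
  by rewrite !nth_default ?sQ ?mulr0 ?subrr // (leq_trans pm).
exists (fun k => if k == m then c0 else c k).
rewrite big_ord_recr /= eqxx -[LHS](subrK (c0 *: Q m)) pc; congr (_ + _).
by apply: eq_bigr => i _; rewrite ltn_eqF.
Qed.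

Lemma orthogonal_lt (F : fieldType) (ell : {scalar {poly F}})
    (Q : nat -> {poly F}) (p : {poly F}) (k : nat) :
  orthogonal_system F ell Q -> (size p <= k)%N -> ell (p * Q k) = 0.
Proof.
move=> [sQ oQ _] /(graded_expansion _ _ sQ) [c ->].
rewrite mulr_suml linear_sum big1 // => l _.
by rewrite -scalerAl linearZ /= oQ ?mulr0 // ltn_eqF.
Qed.

Lemma orthogonal_expansion (F : fieldType) (ell : {scalar {poly F}})
    (Q : nat -> {poly F}) (p : {poly F}) (m : nat) :
  orthogonal_system F ell Q -> (size p <= m)%N ->
  p = \sum_(k < m) (ell (p * Q k) / ell (Q k * Q k)) *: Q k.
Proof.
move=> [sQ oQ nQ] /(graded_expansion _ _ sQ) [c pc].
rewrite {1}pc; apply: eq_bigr => k _; congr (_ *: _).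
rewrite pc mulr_suml linear_sum (bigD1 k) //= big1 => [|l lk].
  by rewrite addr0 -scalerAl linearZ /= mulfK.
by rewrite -scalerAl linearZ /= oQ ?mulr0.
Qed.

Lemma orthogonal_coef (F : fieldType) (ell : {scalar {poly F}})
    (Q : nat -> {poly F}) (p : {poly F}) (m : nat) :
  orthogonal_system F ell Q -> (size p <= m.+1)%N ->
  p`_m = ell (p * Q m) / ell (Q m * Q m) * lead_coef (Q m).
Proof.
move=> hQ pm; have [sQ _ _] := hQ.
rewrite {1}(orthogonal_expansion _ _ _ _ _ hQ pm) big_ord_recr /= coefD coefZ.
rewrite -(graded_lead_coef _ _ _ (sQ m)) coef_sum big1 ?add0r // => k _.
by rewrite coefZ nth_default ?mulr0 // sQ.
Qed.

(** For [k < n] the polynomial [(s - X) Q_k] has degree at most [n], so the hypotheses on [e] and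
    [g] give the same value [phi ((s - X) Q_k)] and cancel. Only the coefficients of [f] along [Q n]
    and [Q n.+1] remain to be computed. *)
Lemma christoffel_darboux_step (F : fieldType) (ell : {scalar {poly F}})
    (Q : nat -> {poly F}) (n : nat) (s : F) (phi : {scalar {poly F}})
    (e g : {poly F}) :
  orthogonal_system F ell Q -> (size e <= n.+1)%N -> (size g <= n.+1)%N ->
  (forall p : {poly F}, (size p <= n.+1)%N -> ell (p * e) = phi p) ->
  (forall p : {poly F}, (size p <= n.+1)%N ->
    ell (p * g) = phi ((s%:P - 'X) * p)) ->
  (s%:P - 'X) * e - g =
  (lead_coef (Q n) / (lead_coef (Q n.+1) * ell (Q n * Q n))) *:
    (phi (Q n.+1) *: Q n - phi (Q n) *: Q n.+1).
Proof.
move=> hQ se sg he hg; have [sQ oQ nQ] := hQ.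
have lQ k : lead_coef (Q k) != 0 by rewrite lead_coef_eq0 -size_poly_eq0 sQ.
have sXM (p : {poly F}) (m : nat) :
    (size p <= m)%N -> (size ((s%:P - 'X) * p)%R <= m.+1)%N.
  move=> pm; rewrite -opprB mulNr size_polyN (leq_trans (size_polyMleq _ _)) //.
  by rewrite size_XsubC.
have coefXM (p : {poly F}) (m : nat) :
    (size p <= m.+1)%N -> ((s%:P - 'X) * p)`_m.+1 = - p`_m.
  by move=> pm; rewrite mulrBl coefB coefCM coefXM /= nth_default ?mulr0 ?sub0r.
set f := _ - g.
have sf : (size f <= n.+2)%N.
  by rewrite (leq_trans (size_polyD _ _)) // geq_max size_polyN sXM //= leqW.
rewrite (orthogonal_expansion _ _ _ _ _ hQ sf) !big_ord_recr /= big1 ?add0r;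
  last first.
  move=> k _; have sk : (size (Q k) <= n)%N by rewrite sQ.
  rewrite [f * _]mulrC mulrBr mulrCA mulrA linearB /= he ?sXM // hg ?sQ ?subrr.
    by rewrite mul0r scale0r.
  exact: leqW.
have eQ : ell (Q n.+1 * e) = 0 by rewrite mulrC; apply: orthogonal_lt hQ _.
(* The top coefficient of [f] is minus the coefficient of degree [n] of [e], which is determined by
   [ell (Q n * e) = phi (Q n)]. *)
have -> : ell (f * Q n.+1) / ell (Q n.+1 * Q n.+1) =
    - (phi (Q n) * lead_coef (Q n) / (lead_coef (Q n.+1) * ell (Q n * Q n))).
  apply: (mulIf (lQ n.+1)); rewrite -orthogonal_coef // coefB coefXM //.
  rewrite (nth_default _ sg) subr0 (orthogonal_coef _ _ _ _ _ hQ se).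
  by rewrite [e * _]mulrC he ?sQ //; field; rewrite nQ lQ.
(* The hypothesis [he] does not reach [(s - X) Q_n], of degree [n + 1]. The constant [gam] cancels
   its leading term against [Q n.+1], to which [e] is orthogonal; the terms [phi u] then cancel. *)
pose gam := lead_coef (Q n) / lead_coef (Q n.+1).
pose u := (s%:P - 'X) * Q n + gam *: Q n.+1.
have su : (size u <= n.+1)%N.
  apply/leq_sizeP => j; rewrite leq_eqVlt => /predU1P[<-|nj].
    rewrite coefD coefXM ?sQ // coefZ -!(graded_lead_coef _ _ _ (sQ _)).
    by rewrite divfK // addNr.
  rewrite nth_default // (leq_trans _ nj) // (leq_trans (size_polyD _ _)) //.
  by rewrite geq_max sXM ?sQ //= (leq_trans (size_scale_leq _ _)) ?sQ.
have -> : ell (f * Q n) = gam * phi (Q n.+1).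
  rewrite mulrBl linearB /= [g * _]mulrC hg ?sQ // mulrAC.
  have -> : (s%:P - 'X) * Q n = u - gam *: Q n.+1 by rewrite /u addrK.
  rewrite mulrBl -scalerAl !(linearB, linearZ) /= eQ he //.
  by rewrite mulr0; ring.
rewrite scalerBr !scalerA -scaleNr; congr (_ *: _ + _ *: _); rewrite /gam.
  by field; rewrite nQ lQ.
by field; rewrite nQ lQ.
Qed.

Lemma christoffel_darboux_deriv (F : fieldType) (ell : {scalar {poly F}})
    (Q : nat -> {poly F}) (n : nat) (s t : F) (d : {poly F}) :
  orthogonal_system F ell Q -> (size d <= n.+1)%N ->
  (forall p : {poly F}, (size p <= n.+1)%N -> ell (p * d) = p^`().[s]) ->
  t != s ->
  d.[t] = lead_coef (Q n) / (lead_coef (Q n.+1) * ell (Q n * Q n)) *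
    (((Q n.+1)^`().[s] * (Q n).[t] - (Q n)^`().[s] * (Q n.+1).[t] -
      ((Q n.+1).[s] * (Q n).[t] - (Q n).[s] * (Q n.+1).[t]) / (s - t)) /
     (s - t)).
Proof.
move=> hQ sd hd ts; have [sQ oQ nQ] := hQ.
have st : s - t != 0 by rewrite subr_eq0 eq_sym.
set c := _ / _.
(* The reproducing kernel at [s]: it represents evaluation there. *)
pose k := \sum_(i < n.+1) ((Q i).[s] / ell (Q i * Q i)) *: Q i.
have sk : (size k <= n.+1)%N.
  apply: (leq_trans (size_sum _ _ _)); apply/bigmax_leqP => i _.
  by rewrite (leq_trans (size_scale_leq _ _)) // sQ.
have hk (p : {poly F}) : (size p <= n.+1)%N -> ell (p * k) = p.[s].
  move=> sp; rewrite {2}(orthogonal_expansion _ _ _ _ _ hQ sp) mulr_sumr.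
  rewrite linear_sum horner_sum; apply: eq_bigr => i _.
  by rewrite -scalerAr linearZ hornerZ /=; ring.
have kt : (s - t) * k.[t] =
    c * ((Q n.+1).[s] * (Q n).[t] - (Q n).[s] * (Q n.+1).[t]).
  (* Here [g = 0], because [(s - X) p] vanishes at [s]. *)
  have := @christoffel_darboux_step F ell Q n s (horner_eval s) k 0 hQ sk.
  rewrite size_poly0 => /(_ isT hk) h.
  have /h /(congr1 (horner^~ t)) : forall p : {poly F}, (size p <= n.+1)%N ->
      ell (p * 0) = horner_eval s ((s%:P - 'X) * p).
    move=> p _; rewrite mulr0 linear0 /= horner_evalE.
    by rewrite hornerM !hornerE subrr mul0r.
  rewrite /= /horner_eval.
  rewrite !(hornerM, hornerD, hornerN, hornerC, hornerX, hornerZ).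
  by rewrite oppr0 addr0.
have dt : (s - t) * d.[t] + k.[t] =
    c * ((Q n.+1)^`().[s] * (Q n).[t] - (Q n)^`().[s] * (Q n.+1).[t]).
  (* Here [g = - k], because the derivative of [(s - X) p] at [s] is [- p(s)]. *)
  have := @christoffel_darboux_step F ell Q n s
    (horner_eval s \o (@deriv F)) d (- k) hQ sd.
  rewrite size_polyN => /(_ sk hd) h.
  have /h /(congr1 (horner^~ t)) : forall p : {poly F}, (size p <= n.+1)%N ->
      ell (p * - k) = horner_eval s ((s%:P - 'X) * p)^`().
    move=> p sp; rewrite mulrN linearN /= hk // horner_evalE.
    rewrite derivM derivB derivC derivX.
    by rewrite !(hornerM, hornerD, hornerN, hornerC, hornerX); ring.
  rewrite /= /horner_eval.
  rewrite !(hornerM, hornerD, hornerN, hornerC, hornerX, hornerZ).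
  by rewrite opprK.
have -> : d.[t] =
    ((s - t) * ((s - t) * d.[t] + k.[t]) - (s - t) * k.[t]) / (s - t) ^+ 2.
  by field.
by rewrite dt kt; field.
Qed.

(** * Jacobi polynomials *)

(* [d/dx ((1-x)^(a+1) (1+x)^(b+1)) = (1-x)^a (1+x)^b (b - a - (a+b+2) x)]: the
   identity says that [((1-x)^(a+1) (1+x)^(b+1) q)'] integrates to [0]. *)
Definition pearson_identity (F : fieldType) (ell : {scalar {poly F}})
    (a b : F) : Prop :=
  forall q : {poly F}, ell ((1 - 'X ^+ 2) * q^`() +
    ((b - a)%:P - (a + b + 2) *: 'X) * q) = 0.

(** The second-order operator of the Jacobi differential equation. *)
Definition jacobi_operator (F : fieldType) (a b : F) (y : {poly F}) :
    {poly F} :=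
  (1 - 'X ^+ 2) * y^`()^`() + ((b - a)%:P - (a + b + 2) *: 'X) * y^`().

(** The coefficients of [y] beyond [k] vanish, which leaves a diagonal action in top degree: this
    yields both the degree bound and the eigenvalue of the operator. *)
Lemma jacobi_operator_coef (F : fieldType) (a b : F) (y : {poly F}) (k : nat) :
  (size y <= k.+1)%N ->
  (jacobi_operator F a b y)`_k = - (k%:R * (k%:R + (a + b + 1))) * y`_k.
Proof.
move=> yk; have y0 i : (k < i)%N -> y`_i = 0.
  by move=> ki; rewrite nth_default // (leq_trans yk).
rewrite /jacobi_operator mulrBl mul1r mulrBl -scalerAl !(coefD, coefN, coefZ).
rewrite coefXnM coefXM coefCM !coef_deriv (y0 k.+1) // (y0 k.+2) // !mul0rn.
case: k {yk y0} => [|[|k]] /=; rewrite ?coef_deriv; [by ring|by ring|].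
by rewrite !subSS subn0; ring.
Qed.

Lemma size_jacobi_operator (F : fieldType) (a b : F) (y : {poly F}) :
  (size (jacobi_operator F a b y) <= size y)%N.
Proof.
apply/leq_sizeP => j yj; rewrite jacobi_operator_coef ?leqW //.
by rewrite nth_default ?mulr0.
Qed.

(** This is the Pearson identity for [y' q]. The right-hand side is symmetric in [y] and [q], so the
    operator is self-adjoint for [ell]. *)
Lemma jacobi_operator_ibp (F : fieldType) (ell : {scalar {poly F}}) (a b : F)
    (y q : {poly F}) :
  pearson_identity F ell a b ->
  ell (jacobi_operator F a b y * q) = - ell ((1 - 'X ^+ 2) * (y^`() * q^`())).
Proof.
move=> /(_ (y^`() * q)) h; apply/eqP; rewrite -addr_eq0 -linearD -h /=.
apply/eqP; congr (ell _); rewrite /jacobi_operator derivM.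
by ring.
Qed.

(** The operator is self-adjoint and does not raise degrees, so the image of [Q k] is orthogonal to
    every [Q l] with [l < k] and is a multiple of [Q k]. Comparing leading coefficients gives the
    factor. *)
Lemma jacobi_ode (F : fieldType) (ell : {scalar {poly F}}) (a b : F)
    (Q : nat -> {poly F}) (k : nat) :
  orthogonal_system F ell Q ->
  pearson_identity F ell a b ->
  jacobi_operator F a b (Q k) = - (k%:R * (k%:R + (a + b + 1))) *: Q k.
Proof.
move=> hQ hp; have [sQ oQ nQ] := hQ.
have lQ : lead_coef (Q k) != 0 by rewrite lead_coef_eq0 -size_poly_eq0 sQ.
have sJ : (size (jacobi_operator F a b (Q k)) <= k.+1)%N.
  by rewrite (leq_trans (size_jacobi_operator _ _ _ _)) ?sQ.
rewrite (orthogonal_expansion _ _ _ _ _ hQ sJ) big_ord_recr /= big1 ?add0r.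
  congr (_ *: _); apply: (mulIf lQ); rewrite -(orthogonal_coef _ _ _ _ _ hQ sJ).
  by rewrite jacobi_operator_coef ?sQ // (graded_lead_coef _ _ _ (sQ k)).
move=> l _; rewrite jacobi_operator_ibp // [_^`() * _]mulrC.
rewrite -(jacobi_operator_ibp _ _ _ _ _ _ hp).
rewrite (orthogonal_lt _ _ _ _ _ hQ) ?mul0r ?scale0r //.
by rewrite (leq_trans (size_jacobi_operator _ _ _ _)) ?sQ.
Qed.

(** At [1] the second-order term of the differential equation drops out, and the first-order
    coefficient becomes [- 2 (a + 1)]. *)
Lemma jacobi_deriv_at1 (F : fieldType) (ell : {scalar {poly F}}) (a b : F)
    (Q : nat -> {poly F}) (k : nat) :
  orthogonal_system F ell Q ->
  pearson_identity F ell a b ->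
  2 * (a + 1) * (Q k)^`().[1] = k%:R * (k%:R + (a + b + 1)) * (Q k).[1].
Proof.
move=> hQ hp; have /(congr1 (horner^~ 1)) := jacobi_ode _ _ _ _ _ k hQ hp.
rewrite /jacobi_operator.
rewrite !(hornerM, hornerD, hornerN, hornerC, hornerX, hornerXn, hornerZ).
by rewrite mulNr => h; rewrite -[RHS]opprK -h; ring.
Qed.

(** For [l < k], writing [Q1 l] as the derivative of a primitive and integrating by parts moves the
    operator onto that primitive. The result has degree at most [l + 1 < k + 1], hence is orthogonal
    to [Q k.+1]. *)
Lemma jacobi_deriv (F : numFieldType) (ell ell1 : {scalar {poly F}}) (a b : F)
    (Q Q1 : nat -> {poly F}) (k : nat) :
  orthogonal_system F ell Q -> orthogonal_system F ell1 Q1 ->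
  (forall p : {poly F}, ell1 p = ell ((1 - 'X ^+ 2) * p)) ->
  pearson_identity F ell a b ->
  exists c, (Q k.+1)^`() = c *: Q1 k.
Proof.
move=> hQ hQ1 h1 hp; have [sQ oQ nQ] := hQ; have [sQ1 _ _] := hQ1.
have sd : (size (Q k.+1)^`() <= k.+1)%N.
  by rewrite -ltnS -(sQ k.+1) lt_size_deriv // -size_poly_eq0 sQ.
exists (ell1 ((Q k.+1)^`() * Q1 k) / ell1 (Q1 k * Q1 k)).
rewrite {1}(orthogonal_expansion _ _ _ _ _ hQ1 sd) big_ord_recr /= big1
  ?add0r // => l _.
rewrite h1 -{1}[Q1 l](deriv_primitive _) [_^`() * _]mulrC.
rewrite -[ell _]opprK -(jacobi_operator_ibp _ _ a b) //.
rewrite (orthogonal_lt _ _ _ _ _ hQ) ?oppr0 ?mul0r ?scale0r //.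
rewrite (leq_trans (size_jacobi_operator _ _ _ _)) //.
by rewrite (leq_trans (size_poly_primitive _ _)) // sQ1 ltnS ltn_ord.
Qed.

(** The bridge from integrals to the algebraic setting: the integral is packed as a linear form. *)
Lemma jacobi_orthogonal_system (R : realType) (a b : R) (Q : nat -> {poly R}) :
  -1 < a -> -1 < b -> is_jacobi a b Q ->
  exists ell : {scalar {poly R}},
    [/\ forall p, ell p = jacobi_functional R a b p,
        orthogonal_system R ell Q & pearson_identity R ell a b].
Proof.
move=> a1 b1 [sQ oQ _].
pose m := GRing.isLinear.Build R {poly R} R *%R (jacobi_functional R a b)
  (jacobi_functional_linear R a b a1 b1).
pose ell : {scalar {poly R}} := HB.pack (jacobi_functional R a b) m.
exists ell; split => //.
- split=> // [k l kl|k].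
    by rewrite -[LHS]/(jacobi_functional R a b _) -jacobi_ipE oQ.
  rewrite gt_eqF //; apply: jacobi_functional_sqr_gt0 => //.
  by rewrite -size_poly_eq0 sQ.
- by move=> q; exact: jacobi_functional_pearson.
Qed.

(** * Normalized Jacobi polynomials: derivatives and leading coefficients *)

Lemma pochhammerS (R : realType) (z : R) (k : nat) :
  pochhammer z k.+1 = z * pochhammer (z + 1) k.
Proof.
rewrite /pochhammer big_ord_recl addr0; congr (_ * _).
by apply: eq_bigr => i _; rewrite lift0 -addrA -natr1 [1 + _]addrC.
Qed.

Lemma pochhammer_gt0 (R : realType) (z : R) (k : nat) :
  0 < z -> 0 < pochhammer z k.
Proof. by move=> z0; apply: prodr_gt0 => i _; rewrite ltr_wpDr. Qed.

(** Proportionality is already known; the constant is found at the point [1], where the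
    normalizations give both polynomials and the differential equation gives the derivative. *)
Lemma jacobi_polynomial_deriv (R : realType) (P : R -> R -> nat -> {poly R})
    (hP : forall a b : R, -1 < a -> -1 < b -> is_jacobi a b (P a b))
    (a b : R) (k : nat) :
  -1 < a -> -1 < b ->
  (P a b k.+1)^`() =
  (1 / 2 * (k.+1%:R + (a + b + 1))) *: P (a + 1) (b + 1) k.
Proof.
move=> a1 b1; have a0 : 0 < a + 1 by rewrite -ltrBlDr sub0r.
have b0 : 0 < b + 1 by rewrite -ltrBlDr sub0r.
have a1' : -1 < a + 1 by rewrite (lt_trans a1) ?ltrDl.
have b1' : -1 < b + 1 by rewrite (lt_trans b1) ?ltrDl.
have [ell [ellE hQ hp]] :=
  jacobi_orthogonal_system _ _ _ _ a1 b1 (hP _ _ a1 b1).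
have [ell1 [ell1E hQ1 _]] :=
  jacobi_orthogonal_system _ _ _ _ a1' b1' (hP _ _ a1' b1').
have h1 p : ell1 p = ell ((1 - 'X ^+ 2) * p).
  by rewrite ellE ell1E jacobi_functionalS.
have [c dP] := jacobi_deriv _ _ _ _ _ _ _ k hQ hQ1 h1 hp.
rewrite dP; congr (_ *: _).
have [_ _ /(_ k.+1) P1] := hP _ _ a1 b1; have [_ _ /(_ k) Q1] := hP _ _ a1' b1'.
have := jacobi_deriv_at1 _ _ _ _ _ k.+1 hQ hp.
rewrite dP hornerZ P1 Q1 pochhammerS factS natrM.
have p0 : pochhammer (a + 1 + 1) k != 0.
  by rewrite gt_eqF // pochhammer_gt0 // addr_gt0.
have f0 : k`!%:R != 0 :> R by rewrite pnatr_eq0 -lt0n fact_gt0.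
have k0 : k.+1%:R != 0 :> R by rewrite pnatr_eq0.
have a0' : a + 1 != 0 by rewrite gt_eqF.
move: (pochhammer (a + 1 + 1) k) p0 (k`!%:R) f0 (k.+1%:R) k0.
move=> u p0 v f0 w k0 h.
have nz : 2 * (a + 1) * u / v != 0 by rewrite !mulf_neq0 ?invr_neq0 ?pnatr_eq0.
apply: (mulfI nz); transitivity (2 * (a + 1) * (c * (u / v))); first by ring.
by rewrite h; field; rewrite f0 k0.
Qed.

Lemma jacobi_lead_coef_deriv (R : realType) (P : R -> R -> nat -> {poly R})
    (hP : forall a b : R, -1 < a -> -1 < b -> is_jacobi a b (P a b))
    (a b : R) (k : nat) :
  -1 < a -> -1 < b ->
  k.+1%:R * lead_coef (P a b k.+1) =
  1 / 2 * (k.+1%:R + (a + b + 1)) * lead_coef (P (a + 1) (b + 1) k).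
Proof.
move=> a1 b1.
have a1' : -1 < a + 1 by rewrite (lt_trans a1) ?ltrDl.
have b1' : -1 < b + 1 by rewrite (lt_trans b1) ?ltrDl.
have [sP _ _] := hP _ _ a1 b1; have [sP1 _ _] := hP _ _ a1' b1'.
have /(congr1 (fun p : {poly R} => p`_k)) :=
  jacobi_polynomial_deriv R P hP a b k a1 b1.
rewrite coef_deriv coefZ !(graded_lead_coef _ _ _ (sP _)).
by rewrite (graded_lead_coef _ _ _ (sP1 _)) => <-; rewrite mulr_natl.
Qed.

(* Multiplied out, because [2n + a + b + 1] may vanish when [n = 0]. *)
Lemma jacobi_lead_coefS (R : realType) (P : R -> R -> nat -> {poly R})
    (hP : forall a b : R, -1 < a -> -1 < b -> is_jacobi a b (P a b))
    (a b : R) (n : nat) :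
  -1 < a -> -1 < b ->
  lead_coef (P a b n) * pochhammer (2 * n%:R + (a + b + 1)) 2 =
  2 * ((n%:R + 1) * (n%:R + (a + b + 1))) * lead_coef (P a b n.+1).
Proof.
have pochE (z : R) : pochhammer z 2 = z * (z + 1).
  by rewrite pochhammerS pochhammerS /pochhammer big_ord0 mulr1.
have lead0 (a' b' : R) : -1 < a' -> -1 < b' -> lead_coef (P a' b' 0) = 1.
  move=> a1 b1; have [sP _ /(_ 0%N)] := hP _ _ a1 b1.
  have /size_poly1P [c _ ->] : size (P a' b' 0) == 1 by rewrite sP.
  by rewrite hornerC lead_coefC /pochhammer big_ord0 divr1.
(* The exponents stay general, since differentiation lowers the degree by one and raises both
   exponents by one. *)
elim: n a b => [|n IH] a b a1 b1; rewrite pochE.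
all: have a1' : -1 < a + 1 by rewrite (lt_trans a1) ?ltrDl.
all: have b1' : -1 < b + 1 by rewrite (lt_trans b1) ?ltrDl.
  have := jacobi_lead_coef_deriv R P hP a b 0 a1 b1.
  by rewrite !lead0 // mulr1n mul1r => ->; field.
have h1 := jacobi_lead_coef_deriv R P hP a b n a1 b1.
have h2 := jacobi_lead_coef_deriv R P hP a b n.+1 a1 b1.
have := IH _ _ a1' b1'; rewrite pochE.
move: h1 h2; rewrite -(natr1 n.+1) -(natr1 n).
have n0 : n%:R + 1 != 0 :> R by rewrite natr1 pnatr_eq0.
set l1 := lead_coef (P a b n.+1); set l2 := lead_coef (P a b n.+2).
set m0 := lead_coef (P _ _ n); set m1 := lead_coef (P _ _ n.+1).
move: (n%:R : R) n0 => x x0 h1 h2 h3.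
apply: (mulfI x0).
transitivity ((x + 1) * l1 *
  ((2 * (x + 1) + (a + b + 1)) * (2 * (x + 1) + (a + b + 1) + 1))).
  by ring.
rewrite h1.
(* Raising both exponents adds [2] to [a + b + 1], which compensates the drop from [n + 1] to [n]:
   the Pochhammer factor is exactly the one in the induction hypothesis. *)
transitivity (1 / 2 * (x + 1 + (a + b + 1)) * (m0 *
  ((2 * x + (a + 1 + (b + 1) + 1)) * (2 * x + (a + 1 + (b + 1) + 1) + 1)))).
  by ring.
rewrite h3.
transitivity (2 * (x + 1) * (x + 1 + (a + b + 1)) * ((x + 1 + 1) * l2));
  last by ring.
by rewrite h2; ring.
Qed.

(** * The dual polynomials *)

Lemma horner_divp_XsubC (F : fieldType) (p : {poly F}) (s : F) :
  root p s -> (p %/ ('X - s%:P)).[s] = p^`().[s].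
Proof.
move=> ps; rewrite [in RHS](root_divp_XsubC _ _ _ ps) derivM derivXsubC.
by rewrite hornerD !hornerM hornerXsubC subrr hornerC; ring.
Qed.

Lemma eq_poly_on_nodes (F : fieldType) (n : nat) (x : nat -> F)
    (p q : {poly F}) :
  {in gtn n &, injective x} -> (size p <= n)%N -> (size q <= n)%N ->
  (forall i, (i < n)%N -> p.[x i] = q.[x i]) -> p = q.
Proof.
move=> xI sp sq pq; apply/eqP; rewrite -subr_eq0; apply/eqP.
apply: (@roots_geq_poly_eq0 _ _ (mkseq x n)).
- apply/allP => _ /mapP[i + ->]; rewrite mem_iota => /= /pq pqi.
  by rewrite rootE hornerD hornerN pqi subrr.
- rewrite map_inj_in_uniq ?iota_uniq // => i j.
  by rewrite !mem_iota => /= /xI; apply.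
- rewrite size_mkseq (leq_trans (size_polyD _ _)) // geq_max sp size_polyN //=.
Qed.

(** At a double root, the quotient of [A] by the linear factor would still vanish at all [n] nodes,
    although it is nonzero of degree [n - 1]. *)
Lemma deriv_node_neq0 (F : fieldType) (n : nat) (x : nat -> F) (A : {poly F}) :
  {in gtn n &, injective x} -> size A = n.+1 ->
  (forall i, (i < n)%N -> root A (x i)) ->
  forall i, (i < n)%N -> A^`().[x i] != 0.
Proof.
move=> xI sA rA i ni; apply/eqP => dA0.
have A0 : A != 0 by rewrite -size_poly_eq0 sA.
have qE := root_divp_XsubC _ _ _ (rA i ni).
have sq : size (A %/ ('X - (x i)%:P)) = n.
  by rewrite size_divp ?polyXsubC_eq0 // size_XsubC sA subn1.
have : A %/ ('X - (x i)%:P) = 0.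
  apply: (eq_poly_on_nodes _ _ _ _ _ xI); rewrite ?sq ?size_poly0 // => k nk.
  rewrite horner0; have [->|ki] := eqVneq k i.
    by rewrite horner_divp_XsubC // rA.
  have /rootP := rA k nk; rewrite {1}qE hornerM hornerXsubC => /eqP.
  rewrite mulf_eq0 subr_eq0 => /orP[/eqP //|/eqP /xI] ki'.
  by move: ki; rewrite ki' ?eqxx.
by move/eqP; rewrite -size_poly_eq0 sq -leqn0 leqNgt (leq_trans _ ni).
Qed.

(** The quotient of [A] by [X - x_i] vanishes at the other nodes and equals [A'(x_i)] at [x_i], so
    both sides agree at [n] points. *)
Lemma lagrange_interpolation (F : fieldType) (n : nat) (x : nat -> F)
    (A r : {poly F}) :
  {in gtn n &, injective x} -> size A = n.+1 ->
  (forall i, (i < n)%N -> root A (x i)) -> (size r <= n)%N ->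
  r = \sum_(i < n) (r.[x i] / A^`().[x i]) *: (A %/ ('X - (x i)%:P)).
Proof.
move=> xI sA rA sr; apply: (eq_poly_on_nodes _ _ _ _ _ xI) => //.
  apply: (leq_trans (size_sum _ _ _)); apply/bigmax_leqP => i _.
  rewrite (leq_trans (size_scale_leq _ _)) // size_divp ?polyXsubC_eq0 //.
  by rewrite size_XsubC sA subn1.
move=> k nk; rewrite horner_sum (bigD1 (Ordinal nk)) //= big1 => [|i ik].
  rewrite addr0 hornerZ horner_divp_XsubC ?rA // divfK //.
  exact: (deriv_node_neq0 _ _ _ _ xI sA rA).
rewrite hornerZ; have /rootP := rA k nk.
rewrite {1}(root_divp_XsubC _ _ _ (rA i (ltn_ord i))) hornerM hornerXsubC.
move/eqP; rewrite mulf_eq0 subr_eq0 => /orP[/eqP ->|/eqP /xI ki].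
  by rewrite mulr0.
by case/eqP: ik; apply: val_inj; rewrite /= ki // inE.
Qed.

Lemma deriv_eq0_const (F : numFieldType) (p : {poly F}) :
  p^`() = 0 -> p = (p`_0)%:P.
Proof.
move=> dp; apply/polyP => -[|i]; rewrite coefC //=.
have /eqP := congr1 (fun q : {poly F} => q`_i) dp.
by rewrite coef_deriv coef0 mulrn_eq0 => /eqP.
Qed.

Lemma Gauss_poly_deriv (R : realType) (L : nat -> {poly R}) (n : nat)
    (tau : nat -> R) (i : nat) :
  (Gauss_poly R L n tau i)^`() =
  (n%:R * (L n.-1).[tau i] / 2) *: (L n %/ ('X - (tau i)%:P)).
Proof.
by rewrite /Gauss_poly derivB derivZ derivB !derivC !subr0 deriv_primitive.
Qed.

(** Interpolating [p'] at the nodes and integrating writes [p] as a constant plus a combination of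
    the [G_i]. The constant is a multiple of [G_0], hence killed by [dG j] as [j >= 1], and duality
    selects the term of index [j]. *)
Lemma dual_G_represents (R : realType) (ell : {scalar {poly R}})
    (L : nat -> {poly R}) (n : nat) (a b : R) (tau : nat -> R)
    (dG : nat -> {poly R}) (j : nat) :
  (forall p, ell p = jacobi_functional R a b p) ->
  is_legendre L -> is_gauss_nodes L n tau -> is_dual_G L n tau a b dG ->
  (1 <= j <= n)%N ->
  gauss_weight L n tau j != 0 /\
  forall p : {poly R}, (size p <= n.+1)%N ->
    ell (p * dG j) = gauss_weight L n tau j * p^`().[tau j].
Proof.
move=> ellE [sL _ _] [_ tauM rL] [sG hG] /andP[j1 jn].
have n0 : (0 < n)%N by rewrite (leq_trans j1).
have rt i : (1 <= i <= n)%N -> root (L n) (tau i).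
  by move=> hi; apply/rL; exists i.
have hell i k : (1 <= i <= n)%N -> (k <= n)%N ->
    ell (Gauss_poly R L n tau i * dG k) = (i == k)%:R.
  move=> hi kn; rewrite -hG //; last by case/andP: hi.
  rewrite ellE -jacobi_ipE; apply: eq_Rintegral => x.
  rewrite inE /= in_itv /= => /andP[x1 _].
  by rewrite GpolyE ?rt //; case/andP: hi.
have hell0 k : (1 <= k <= n)%N -> ell (dG k) = 0.
  move=> /andP[k1 kn]; have := hG 0%N k (leq0n _) kn.
  rewrite eq_sym eqn0Ngt k1 /= => h.
  have : ell ((1 / 2)%:P * dG k) = 0.
    rewrite ellE -jacobi_ipE -[RHS]h; apply: eq_Rintegral => x _.
    by rewrite hornerC.
  rewrite mul_polyC linearZ /= => /eqP.
  by rewrite mulf_eq0 mul1r invr_eq0 pnatr_eq0 /= => /eqP.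
(* This follows from duality: otherwise [G_i] would be constant, hence orthogonal to [dG i], whereas
   their inner product is [1]. *)
have L1 i : (1 <= i <= n)%N -> (L n.-1).[tau i] != 0.
  move=> hi; apply/eqP => L0; have /andP[_ le_in] := hi.
  have := hell i i hi le_in.
  rewrite /Gauss_poly L0 mulr0 mul0r scale0r sub0r eqxx.
  rewrite mulNr mul_polyC linearN linearZ /= hell0 // mulr0 oppr0 => /esym/eqP.
  by rewrite oner_eq0.
(* The interpolation lemmas number the nodes from [0]. *)
pose x i := tau i.+1.
have xI : {in gtn n &, injective x}.
  move=> i k; rewrite !inE => ni nk; case: (ltngtP i k) => // ik /eqP.
    by rewrite lt_eqF // /x tauM // ltnS ik.
  by rewrite gt_eqF // /x tauM // ltnS ik.
have rx i : (i < n)%N -> root (L n) (x i) by move=> ni; apply: rt.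
have dx := deriv_node_neq0 _ _ _ _ xI (sL n) rx.
have nR0 : n%:R != 0 :> R by rewrite pnatr_eq0 -lt0n.
split.
  have := dx j.-1; rewrite /x prednK // => /(_ jn) dj.
  apply: mulf_neq0; first by rewrite pnatr_eq0.
  by apply: invr_neq0; rewrite !mulf_neq0 // L1 // j1.
move=> p sp; have sd : (size p^`() <= n)%N.
  have [->|p0] := eqVneq p 0; first by rewrite deriv0 size_poly0.
  by rewrite -ltnS (leq_trans (lt_size_deriv p0)).
pose g i := (gauss_weight L n tau i.+1 * p^`().[tau i.+1]) *:
  Gauss_poly R L n tau i.+1.
have dp : (p - \sum_(i < n) g i)^`() = 0.
  rewrite derivB linear_sum /=.
  rewrite {1}(lagrange_interpolation _ _ _ _ _ xI (sL n) rx sd).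
  apply/eqP; rewrite subr_eq0; apply/eqP; apply: eq_bigr => i _.
  rewrite derivZ Gauss_poly_deriv scalerA; congr (_ *: _).
  (* The weight times the scaling factor of [Gauss_poly] is the inverse of the derivative of [L n]
     at the node, as in the Lagrange formula. *)
  have := dx i (ltn_ord i); have := L1 i.+1 (ltn_ord i).
  rewrite /gauss_weight /x.
  by move=> ? ?; field; apply/and3P.
rewrite -[p in LHS](subrK (\sum_(i < n) g i)) (deriv_eq0_const _ _ dp).
rewrite mulrDl linearD /= mul_polyC linearZ /= hell0 ?j1 // mulr0 add0r.
have jn' : (j.-1 < n)%N by rewrite prednK.
rewrite mulr_suml linear_sum (bigD1 (Ordinal jn')) //= big1 => [|i ij].
  by rewrite addr0 /g prednK // -scalerAl linearZ /= hell ?j1 // eqxx mulr1.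
rewrite /g -scalerAl linearZ /= hell ?ltn_ord //.
rewrite (_ : (i.+1 == j) = false) ?mulr0 //; apply: contraNF ij => /eqP ij.
by apply/eqP/val_inj; rewrite /= -ij.
Qed.

Theorem theorem3p5 (R : realType) (n : nat) (alpha beta : R)
    (L : nat -> {poly R}) (P : R -> R -> nat -> {poly R})
    (tau : nat -> R) (dG : nat -> {poly R})
    (hn : (1 <= n)%N) (halpha : -1 < alpha) (hbeta : -1 < beta)
    (hL : is_legendre L)
    (hP : forall a b : R, -1 < a -> -1 < b -> is_jacobi a b (P a b))
    (htau : is_gauss_nodes L n tau)
    (hdG : is_dual_G L n tau alpha beta dG) :
  let sigma := alpha + beta + 1 in
  let h := jacobi_sqnorm alpha beta (P alpha beta) in
  let K := jacobi_kernel (P alpha beta) n in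
  let b (i j : nat) :=
    1 / 2 * (i%:R + sigma) * (P (alpha + 1) (beta + 1) i.-1).[tau j] in
  forall (j : nat) (t : R), (1 <= j <= n)%N -> t != tau j ->
    (dG j).[t] =
      2 * gauss_weight L n tau j
      * ((n%:R + 1) * (n%:R + sigma)
         / (h n * pochhammer (2 * n%:R + sigma) 2))
      * ((b n.+1 j * (P alpha beta n).[t] - b n j * (P alpha beta n.+1).[t]
          - K (tau j) t) / (tau j - t)).
Proof.
move=> sigma h K b j t jn tj.
have [ell [ellE hQ hp]] :=
  jacobi_orthogonal_system _ _ _ _ halpha hbeta (hP _ _ halpha hbeta).
have [w0 dGE] := dual_G_represents _ _ _ _ _ _ _ _ _ ellE hL htau hdG jn.
set w := gauss_weight L n tau j in w0 dGE *.
have [sQ oQ nQ] := hQ.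
have sd : (size (w^-1 *: dG j)%R <= n.+1)%N.
  rewrite (leq_trans (size_scale_leq _ _)) //; case: hdG => + _; apply.
  by case/andP: jn.
have hd (p : {poly R}) : (size p <= n.+1)%N ->
    ell (p * (w^-1 *: dG j)) = p^`().[tau j].
  by move=> sp; rewrite -scalerAr linearZ /= dGE // mulKf.
have := christoffel_darboux_deriv _ _ _ _ _ _ _ hQ sd hd tj.
have bE i : (0 < i)%N -> (P alpha beta i)^`().[tau j] = b i j.
  by case: i => // i _; rewrite (jacobi_polynomial_deriv R P hP) // hornerZ.
rewrite !bE // hornerZ /K /jacobi_kernel.
have hE : ell (P alpha beta n * P alpha beta n) = h n.
  by rewrite ellE -jacobi_ipE.
have h0 : h n != 0 by rewrite -hE.
rewrite hE => /(congr1 ( *%R w)); rewrite mulVKf // => ->.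
have := jacobi_lead_coefS R P hP alpha beta n halpha hbeta; rewrite -/sigma.
have lQ : lead_coef (P alpha beta n.+1) != 0.
  by rewrite lead_coef_eq0 -size_poly_eq0 sQ.
have p0 : pochhammer (2 * n%:R + sigma) 2 != 0.
  (* Since [n >= 1] and [alpha + beta > -2], the base [2 n + sigma] exceeds [1]. *)
  rewrite gt_eqF // pochhammer_gt0 // /sigma.
  have n1 : 1 <= n%:R :> R by rewrite ler1n.
  by clear -halpha hbeta n1; lra.
set lc := lead_coef _; set lc1 := lead_coef _ in lQ *.
set q := pochhammer _ _ in p0 *.
move=> lE.
(* The relation [lE] between consecutive leading coefficients turns the Christoffel-Darboux constant
   into the stated prefactor. *)
have -> : lc / (lc1 * h n) = 2 * ((n%:R + 1) * (n%:R + sigma)) / (h n * q).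
  apply: (mulIf p0); transitivity (lc * q / (lc1 * h n)); first by ring.
  by rewrite lE; field; rewrite p0 h0 lQ.
by ring.
Qed.
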